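(* Let $r\ge1$ and let $\alpha_1,\dots,\alpha_r,\beta>-1$ with $\alpha_i-\alpha_j\notin\mathbb{Z}$ whenever $i\ne j$. For $\vec n=(n_1,\dots,n_r)\in\mathbb{N}^r$ let $P_{\vec n}$ be the Jacobi-Piñeiro polynomial, i.e. the monic polynomial of degree $|\vec n|$ satisfying $$\int_0^1P_{\vec n}(x)\,x^k\,x^{\alpha_j}(1-x)^\beta\,dx=0,\qquad k=0,1,\dots,n_j-1,\quad 1\le j\le r.$$ Consider the coefficients in the nearest neighbor recurrence relations $$xP_{\vec n}(x)=P_{\vec n+\vec e_k}(x)+b_{\vec n,k}P_{\vec n}(x)+\sum_{j=1}^ra_{\vec n,j}P_{\vec n-\vec e_j}(x),\qquad 1\le k\le r.$$ Then $$a_{\vec n,j}=\prod_{i=1,\,i\ne j}^r\frac{n_j+\alpha_j-\alpha_i}{n_j-n_i+\alpha_j-\alpha_i}\ \prod_{i=1}^r\frac{|\vec n|+\alpha_i+\beta}{|\vec n|+n_i+\alpha_i+\beta}\cdot\frac{n_j(n_j+\alpha_j)(|\vec n|+\beta)}{(|\vec n|+n_j+\alpha_j+\beta+1)(|\vec n|+n_j+\alpha_j+\beta)(|\vec n|+n_j+\alpha_j+\beta-1)}$$ for $1\le j\le r$, and $$b_{\vec n,k}=\delta_{\vec n}-\delta_{\vec n+\vec e_k},\qquad 1\le k\le r,$$ where $\delta_{\vec n}$, the coefficient of $x^{|\vec n|-1}$ in $P_{\vec n}(x)=x^{|\vec n|}+\delta_{\vec n}x^{|\vec n|-1}+\cdots$,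 is given by $$\delta_{\vec n}=-(|\vec n|+\beta)\,\frac{q_r(-|\vec n|-\beta)}{Q_{r,\vec n}(-|\vec n|-\beta)}+\beta,\qquad q_r(x)=\prod_{j=1}^r(x-\alpha_j),\quad Q_{r,\vec n}(x)=\prod_{j=1}^r(x-n_j-\alpha_j).$$
   Context: $\mathbb{N}=\{0,1,2,\dots\}$, $|\vec n|=n_1+\cdots+n_r$, and $\vec e_j$ is the $j$-th standard unit vector in $\mathbb{N}^r$. All multi-indices are assumed normal, i.e. $P_{\vec n}$ exists and is unique for every $\vec n\in\mathbb{N}^r$. The coefficients $a_{\vec n,j}$ are the same in all $r$ recurrence relations (they do not depend on $k$); when $n_j=0$ the term with $P_{\vec n-\vec e_j}$ is absent.
   Formalization: For exceptional parameters (e.g. r=1, n=0, α+β=0) the printed formulas for a and δ read 0/0; they are asserted literally when all denominators are nonzero, and for all parameters as limits as the formula's β-argument tends to β; δ_0 is taken as 0. *)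

(* Defs.v *)
From HB Require Import structures.
From mathcomp Require Import all_boot all_order all_algebra.
From mathcomp Require Import all_classical all_reals all_analysis.
Import Order.TTheory GRing.Theory Num.Theory numFieldNormedType.Exports.

Set Implicit Arguments.
Unset Strict Implicit.
Unset Printing Implicit Defensive.

Local Open Scope ring_scope.

Section MultiIndices.
Variable r : nat.

Definition multi_index : Type := {ffun 'I_r -> nat}.

Definition weight (n : multi_index) : nat := (\sum_(i < r) n i)%N.

Definition incr_at (n : multi_index) (k : 'I_r) : multi_index :=
  [ffun i => (n i + (i == k))%N].

(* Truncated subtraction: only meaningful when 0 < n j. *)
Definition decr_at (n : multi_index) (j : 'I_r) : multi_index :=
  [ffun i => (n i - (i == j))%N].

End MultiIndices.

Section JacobiPineiro.
Variables (R : realType) (r : nat) (alpha : 'I_r -> R) (beta : R).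
Implicit Types (n : multi_index r) (p : {poly R}) (x : R).

(* The integral is the Lebesgue integral with values in the extended reals, so
   that "= 0" is not met by a default value.  The values of the weight at the
   endpoints (powR 0 a = 0 for a != 0) are irrelevant.  *)
Definition is_jacobi_pineiro n p : Prop :=
  [/\ p \is monic, size p = (weight n).+1 &
      forall (j : 'I_r) (k : nat), (k < n j)%N ->
        (\int[lebesgue_measure]_(x in `[0%R, 1%R]%classic)
           (p.[x] * x ^+ k * (x `^ alpha j) * ((1 - x) `^ beta))%:E = 0%R%:E :> \bar R)%E].

Definition jp_a n (j : 'I_r) : R :=
  let N := (weight n)%:R in
  let nj := (n j)%:R in
  (\prod_(i < r | i != j)
      ((nj + alpha j - alpha i) / (nj - (n i)%:R + alpha j - alpha i)))
  * (\prod_(i < r) ((N + alpha i + beta) / (N + (n i)%:R + alpha i + beta)))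
  * (nj * (nj + alpha j) * (N + beta)
     / ((N + nj + alpha j + beta + 1) * (N + nj + alpha j + beta)
        * (N + nj + alpha j + beta - 1))).

Definition jp_q x : R := \prod_(j < r) (x - alpha j).

Definition jp_Q n x : R := \prod_(j < r) (x - (n j)%:R - alpha j).

Definition jp_delta n : R :=
  let N := (weight n)%:R in
  - (N + beta) * (jp_q (- N - beta) / jp_Q n (- N - beta)) + beta.

End JacobiPineiro.

(* The coefficient of x^(d-1), which is 0 when d = 0.  *)
Definition subleading (R : realType) (d : nat) (p : {poly R}) : R :=
  if d is d'.+1 then p`_d' else 0.

(* The coefficients a n j are common to all r relations (one for each k);
   the absence of the term in P_{n - e_j} when n_j = 0 is also recorded as
   a n j = 0, so that a n j is determined for all n and j. *)
Definition nearest_neighbor_recurrence (R : realType) (r : nat)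
    (P : multi_index r -> {poly R}) (a b : multi_index r -> 'I_r -> R) : Prop :=
  (forall (n : multi_index r) (j : 'I_r), n j = 0%N -> a n j = 0) /\
  (forall (n : multi_index r) (k : 'I_r),
     'X * P n = P (incr_at n k) + b n k *: P n
                + \sum_(j < r | (0 < n j)%N) a n j *: P (decr_at n j)).

(* Main.v *)
Require Import Defs.
From mathcomp Require Import all_boot all_order all_algebra.
From mathcomp Require Import all_classical all_reals all_analysis.
From mathcomp Require Import measurable_realfun zify ring lra.
Import Order.TTheory GRing.Theory Num.Theory numFieldNormedType.Exports.
Local Open Scope classical_set_scope.
Local Open Scope ring_scope.

(* For s, b > -1 the Beta moments B(s) of x^s (1 - x)^b on [0, 1] satisfy
   (s + 1) B(s) = (s + b + 2) B(s + 1).  Hence, for p of degree N, the integral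
   of p(x) x^s (1 - x)^b equals B(s) T(s) / (s + b + 2)_N, where (y)_m is the
   rising factorial and T is a polynomial in s of degree at most N.  For
   p = P_n the orthogonality relations give N distinct zeros alpha_j + k
   (k < n_j) of T, so that
   T(s) = (-1)^N K prod_j (alpha_j - s)_(n_j).  At s = - b - 1 - N only the
   leading coefficient of p contributes to T(s), which gives K; at s = - b - N
   only the two leading coefficients contribute, which gives delta_n.
   Integrating the recurrence relation against x^(alpha_j + n_j - 1) (1 - x)^b
   leaves a single term of the sum, so a_(n,j) is the quotient of the moment of
   P_n of exponent alpha_j + n_j by the moment of P_(n - e_j) of exponent
   alpha_j + n_j - 1. *)

(** * The Beta weight on the unit interval *)

Lemma powR_le1 {R : realType} (x a : R) : 0 <= a -> 0 <= x <= 1 -> x `^ a <= 1.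
Proof.
move=> a0 /andP[x0 x1]; have <- : (1 : R) `^ a = 1 by rewrite powR1.
by rewrite ge0_ler_powR ?nnegrE.
Qed.

Definition beta_weight {R : realType} (s b x : R) : R := x `^ s * (1 - x) `^ b.

Lemma beta_weight_ge0 {R : realType} (s b x : R) : 0 <= beta_weight s b x.
Proof. by rewrite mulr_ge0 ?powR_ge0. Qed.

Lemma beta_weightSl {R : realType} (s b x : R) : 0 < x ->
  beta_weight (s + 1) b x = x * beta_weight s b x.
Proof.
move=> x0; rewrite /beta_weight powRD ?(gt_eqF x0) ?implybT// powRr1 ?ltW//.
by rewrite mulrCA mulrA.
Qed.

Lemma beta_weightSr {R : realType} (s b x : R) : x < 1 ->
  beta_weight s (b + 1) x = (1 - x) * beta_weight s b x.
Proof.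
move=> x1; have x1' : 0 < 1 - x by rewrite subr_gt0.
rewrite /beta_weight powRD ?(gt_eqF x1') ?implybT// powRr1 ?ltW//.
by rewrite mulrA mulrC.
Qed.

Lemma measurable_beta_weight {R : realType} (s b : R) (D : set R) :
  measurable_fun D (beta_weight s b).
Proof.
apply: measurable_funM; apply: measurable_funTS; first exact: measurable_powR.
apply: (measurableT_comp (measurable_powR b)).
exact: measurable_funB.
Qed.

(** In the product rule the factor (1 - x)^(b + 1) is expanded as (1 - x)(1 - x)^b, so that both
    terms carry the exponent b. Integration then yields the Beta recurrence up to a boundary
    term. *)
Lemma is_derive_beta_weight {R : realType} (s b x : R) : 0 < x < 1 ->
  is_derive x 1 (beta_weight (s + 1) (b + 1))
    ((s + 1) * beta_weight s b x
     - (s + b + 2) * beta_weight (s + 1) b x).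
Proof.
case/andP=> x0 x1; have x1' : 0 < 1 - x by rewrite subr_gt0.
have d1 := is_derive1_powR (s + 1) x0.
have d2 : is_derive x 1 ((fun y => y `^ (b + 1)) \o (fun y => 1 - y))
    ((b + 1) * (1 - x) `^ (b + 1 - 1) * (0 - 1)).
  have d : is_derive x 1 (fun y : R => 1 - y) (0 - 1).
    have h := @is_deriveB R R R (cst 1) id x 1 0 1 _ _; exact: h.
  have h := @is_derive1_comp R (fun y => y `^ (b + 1)) (fun y => 1 - y) x _ _
    (is_derive1_powR (b + 1) x1') d.
  exact: h.
refine (is_derive_eq (is_deriveM d1 d2) _).
rewrite beta_weightSl// /beta_weight !addrK /GRing.scale/=.
rewrite !powRD ?(gt_eqF x1') ?(gt_eqF x0) ?implybT// !powRr1 ?ltW//.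
ring.
Qed.

Lemma continuous_beta_weight {R : realType} (s b c d : R) : 0 < c -> d < 1 ->
  {within `[c, d], continuous (beta_weight s b)}.
Proof.
move=> c0 d1; apply: continuous_in_subspaceT => x.
rewrite inE/= in_itv/= => /andP[cx xd].
have x01 : 0 < x < 1 by rewrite (lt_le_trans c0)//= (le_lt_trans xd).
have [+ _] := is_derive_beta_weight (s - 1) (b - 1) x x01.
by rewrite !subrK => /derivable1_diffP/differentiable_continuous.
Qed.

(** * Moments over the shrunken interval [[e, 1 - e]] *)

Section truncated_moment.
Context {R : realType}.
Implicit Types (s b e : R).
Local Notation mu := (@lebesgue_measure R).

(** For negative s or b the weight is unbounded near an endpoint. Cutting off both ends keeps the
    integrand continuous, so that the fundamental theorem of calculus applies. *)
Definition truncated_moment e s b : R :=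
  \int[mu]_(x in `[e, 1 - e]) beta_weight s b x.

Lemma integrable_truncated_moment e s b : 0 < e ->
  mu.-integrable `[e, 1 - e] (EFin \o beta_weight s b).
Proof.
move=> e0; apply: continuous_compact_integrable; first exact: segment_compact.
by apply: continuous_beta_weight => //; rewrite ltrBlDr ltrDl.
Qed.

Lemma EFin_truncated_moment e s b : 0 < e ->
  (\int[mu]_(x in `[e, (1 - e)%R]) (beta_weight s b x)%:E)%E
  = (truncated_moment e s b)%:E.
Proof.
move=> e0; rewrite /truncated_moment /Rintegral fineK//.
exact: integrable_fin_num (integrable_truncated_moment e s b e0).
Qed.

(** The boundary term of the antiderivative; it tends to 0 with e when s, b > -1. *)
Definition moment_defect e s b : R :=
  beta_weight (s + 1) (b + 1) (1 - e) - beta_weight (s + 1) (b + 1) e.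

Lemma truncated_moment_recl e s b : 0 < e -> e < 1 - e ->
  (s + 1) * truncated_moment e s b
  = (s + b + 2) * truncated_moment e (s + 1) b + moment_defect e s b.
Proof.
move=> e0 e1; suff <- : (s + 1) * truncated_moment e s b
    - (s + b + 2) * truncated_moment e (s + 1) b = moment_defect e s b.
  by rewrite [RHS]addrC subrK.
have i1 := integrable_truncated_moment e s b e0.
have i2 := integrable_truncated_moment e (s + 1) b e0.
have in01 x : x \in `[e, 1 - e] -> 0 < x < 1.
  rewrite in_itv/= => /andP[ex xe]; rewrite (lt_le_trans e0)//=.
  by rewrite (le_lt_trans xe)// ltrBlDr ltrDl.
have cF x : x \in `[e, 1 - e] ->
    {for x, continuous (beta_weight (s + 1) (b + 1))}.
  move=> /in01 x01; have [/derivable1_diffP + _] :=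
    is_derive_beta_weight s b x x01.
  exact: differentiable_continuous.
transitivity (\int[mu]_(x in `[e, 1 - e])
   ((s + 1) * beta_weight s b x - (s + b + 2) * beta_weight (s + 1) b x)).
  rewrite RintegralB//; first by rewrite !RintegralZl.
  - have h := @integrableZl _ _ _ mu _ (measurable_itv _) (s + 1) _ i1.
    exact: h.
  - have h := @integrableZl _ _ _ mu _ (measurable_itv _) (s + b + 2) _ i2.
    exact: h.
rewrite /Rintegral.
rewrite (@continuous_FTC2 _ _ (beta_weight (s + 1) (b + 1)))//.
- apply: continuous_in_subspaceT => x.
  rewrite inE/= => /in01 x01.
  have c t : {for x, continuous (beta_weight t b)}.
    have [+ _] := is_derive_beta_weight (t - 1) (b - 1) x x01.
    by rewrite !subrK => /derivable1_diffP/differentiable_continuous.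
  by apply: cvgB; apply: cvgM => //;
    [exact: cvg_cst|exact: c|exact: cvg_cst|exact: c].
- split=> [x xe||].
  + have /in01 x01 : x \in `[e, 1 - e] by exact: subset_itv_oo_cc xe.
    by have [] := is_derive_beta_weight s b x x01.
  + by apply: cvg_at_right_filter; apply: cF; rewrite in_itv/= lexx ltW.
  + by apply: cvg_at_left_filter; apply: cF; rewrite in_itv/= lexx ltW.
- move=> x xe; have /in01 x01 : x \in `[e, 1 - e] by exact: subset_itv_oo_cc xe.
  by rewrite derive1E; have [_ ->] := is_derive_beta_weight s b x x01.
Qed.

Lemma truncated_moment_split e s b : 0 < e ->
  truncated_moment e s b
  = truncated_moment e (s + 1) b + truncated_moment e s (b + 1).
Proof.
move=> e0; rewrite /truncated_moment -RintegralD//;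
  [|exact: integrable_truncated_moment..].
apply: eq_Rintegral => x; rewrite inE/= in_itv/= => /andP[ex xe].
rewrite beta_weightSl ?(lt_le_trans e0)// beta_weightSr; first by ring.
by rewrite (le_lt_trans xe)// ltrBlDr ltrDl.
Qed.

(** Writing 1 = x + (1 - x) under the integral eliminates the exponent s + 1 from the recurrence in
    s and leaves one that raises b. *)
Lemma truncated_moment_recr e s b : 0 < e -> e < 1 - e ->
  (b + 1) * truncated_moment e s b
  = (s + b + 2) * truncated_moment e s (b + 1) - moment_defect e s b.
Proof.
move=> e0 e1; have := truncated_moment_recl e s b e0 e1.
have -> : truncated_moment e s (b + 1)
    = truncated_moment e s b - truncated_moment e (s + 1) b.
  by rewrite (truncated_moment_split e s b e0) [RHS]addrC addKr.
lra.
Qed.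

Lemma beta_weight_le1 s b x : 0 < s -> 0 < b -> 0 <= x <= 1 ->
  beta_weight s b x <= 1.
Proof.
move=> s0 b0 /andP[x0 x1].
by rewrite mulr_ile1 ?powR_ge0 ?powR_le1//; lra.
Qed.

Lemma truncated_moment_le1 e s b : 0 < s -> 0 < b -> 0 < e -> e < 1 - e ->
  truncated_moment e s b <= 1.
Proof.
move=> s0 b0 e0 e1; rewrite -lee_fin -EFin_truncated_moment//.
apply: (@le_trans _ _ (\int[mu]_(x in `[e, (1 - e)%R]) 1)%E).
  apply: ge0_le_integral => //.
  - by move=> x _; rewrite lee_fin beta_weight_ge0.
  - by apply/measurable_EFinP; exact: measurable_beta_weight.
  - move=> x /=; rewrite in_itv/= => /andP[ex xe].
    by rewrite lee_fin beta_weight_le1//; lra.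
rewrite integral_cst//= mul1e lebesgue_measure_itv/= lte_fin e1.
by rewrite -EFinB lee_fin; lra.
Qed.

Lemma normr_moment_defect e s b : -1 < s -> -1 < b -> 0 < e -> e < 1 - e ->
  `|moment_defect e s b| <= e `^ (s + 1) + e `^ (b + 1).
Proof.
move=> s1 b1 e0 e1; rewrite /moment_defect /beta_weight.
rewrite opprB addrCA subrr addr0.
have p1 t : -1 < t -> (1 - e) `^ (t + 1) <= 1.
  by move=> t1; apply: powR_le1; lra.
rewrite (le_trans (ler_normB _ _))// !ger0_norm ?mulr_ge0 ?powR_ge0//.
by rewrite addrC lerD// ?ler_piMr ?ler_piMl ?powR_ge0// p1.
Qed.

(* The recurrences reduce the bound to the exponents s + 1 and b + 1, for which
   the integrand is at most 1. *)
Lemma truncated_moment_bounded s b : -1 < s -> -1 < b ->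
  exists M, forall e, 0 < e -> e < 1 - e -> truncated_moment e s b <= M.
Proof.
move=> s1 b1.
have def t e : -1 < t -> 0 < e -> e < 1 - e -> `|moment_defect e t b| <= 2.
  move=> t1 e0 e1; apply: le_trans (normr_moment_defect _ _ _ _ _ _ _) _ => //.
  have p u : -1 < u -> e `^ (u + 1) <= 1.
    by move=> u1; apply: powR_le1; lra.
  by rewrite (_ : 2 = 1 + 1)// lerD ?p.
(* Each 2 bounds a boundary term. The inner quotient bounds the moment of exponents s + 1 and b by
   the recurrence in b, the outer one the moment of exponents s and b by the recurrence in s. *)
exists ((((s + b + 2) * (((s + b + 3) + 2) / (b + 1))) + 2) / (s + 1)).
move=> e e0 e1.
have := def _ _ s1 e0 e1; rewrite ler_norml => /andP[_ d1].
have s1' : -1 < s + 1 by lra.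
have := def _ _ s1' e0 e1; rewrite ler_norml => /andP[d2 _].
have E1 := truncated_moment_recl e s b e0 e1.
have E2 := truncated_moment_recr e (s + 1) b e0 e1.
have m1 : truncated_moment e (s + 1) (b + 1) <= 1.
  by apply: truncated_moment_le1 => //; lra.
rewrite ler_pdivlMr; last by lra.
rewrite mulrC E1 lerD// ler_pM2l; last by lra.
rewrite ler_pdivlMr; last by lra.
rewrite mulrC E2; apply: lerD; last by lra.
rewrite (_ : s + 1 + b + 2 = s + b + 3); last by ring.
by rewrite ler_piMr//; lra.
Qed.

End truncated_moment.

(** * Beta moments over the whole interval, as limits *)

Section beta_moment.
Context {R : realType}.
Implicit Types (s b e : R).
Local Notation mu := (@lebesgue_measure R).

(** The factor 1/3 makes [[eps n, 1 - eps n]] nondegenerate already for n = 0. *)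
Let eps (n : nat) : R := n.+1%:R^-1 / 3.

Let eps_gt0 n : 0 < eps n. Proof. by rewrite divr_gt0. Qed.

Let eps_lt n : eps n < 1 - eps n.
Proof.
have : n.+1%:R^-1 <= 1 :> R by rewrite invf_le1// ler1n.
by rewrite /eps; move: (n.+1%:R^-1 : R) => t; lra.
Qed.

Let eps_cvg : eps n @[n --> \oo] --> (0 : R).
Proof.
rewrite -[0 in X in _ --> X](mul0r (3^-1 : R)).
by apply: cvgMl; exact: cvg_harmonic.
Qed.

Let eps_nincr : nonincreasing_seq eps.
Proof.
by move=> m n mn; rewrite /eps ler_pM2r ?invr_gt0// lef_pV2 ?posrE// ler_nat.
Qed.

Let bigcup_eps : \bigcup_n `[eps n, 1 - eps n]%classic = `]0, 1[%classic.
Proof.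
apply/seteqP; split=> [x [n _] /=|x /=]; rewrite !in_itv/=.
  by case/andP=> ? ?; have := eps_gt0 n; lra.
case/andP=> x0 x1.
have : \forall n \near \oo, eps n <= Num.min x (1 - x).
  apply: (cvgr_le _ eps_cvg) => //.
  by rewrite lt_min x0 subr_gt0.
case=> N _ /(_ N (leqnn _)); rewrite /= le_min => /andP[h1 h2].
by exists N => //=; rewrite in_itv/= h1/= lerBrDr -lerBrDl.
Qed.

Let itv_eps_nondecr : nondecreasing_seq (fun n => `[eps n, 1 - eps n]%classic).
Proof.
move=> m n mn; apply/subsetPset => x /=; rewrite !in_itv/= => /andP[h1 h2].
by have := eps_nincr _ _ mn; lra.
Qed.

(** Monotone convergence for a nonnegative integrand on growing segments. The limit lives in the
    extended reals, so it is available before integrability, which is deduced from it. *)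
Let cvg_truncated_integral s b :
  ((truncated_moment (eps n) s b)%:E @[n --> \oo] -->
   \int[mu]_(x in `[0%R, 1%R]) (beta_weight s b x)%:E)%E.
Proof.
rewrite integral_itv_bndoo; last first.
  by apply/measurable_EFinP; exact: measurable_beta_weight.
rewrite -bigcup_eps; under eq_fun do rewrite -EFin_truncated_moment//.
apply: ge0_nondecreasing_set_cvg_integral => //.
- by move=> i; apply/measurable_EFinP; exact: measurable_beta_weight.
- by move=> i x _; rewrite lee_fin beta_weight_ge0.
Qed.

Lemma integrable_beta_weight s b : -1 < s -> -1 < b ->
  mu.-integrable `[0, 1] (EFin \o beta_weight s b).
Proof.
move=> s1 b1; apply/integrableP; split.
  by apply/measurable_EFinP; exact: measurable_beta_weight.
under eq_integral do rewrite /= ger0_norm ?beta_weight_ge0//.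
have [M HM] := truncated_moment_bounded s b s1 b1.
apply: (@le_lt_trans _ _ M%:E); last by rewrite ltry.
apply: (@cvge_le _ _ _ _ _ _ _ _ (cvg_truncated_integral s b)).
by apply: nearW => n; rewrite lee_fin; exact: HM.
Qed.

Definition beta_moment s b : R := \int[mu]_(x in `[0, 1]) beta_weight s b x.

Lemma EFin_beta_moment s b : -1 < s -> -1 < b ->
  (\int[mu]_(x in `[0%R, 1%R]) (beta_weight s b x)%:E)%E = (beta_moment s b)%:E.
Proof.
move=> s1 b1; rewrite /beta_moment /Rintegral fineK//.
exact: integrable_fin_num (integrable_beta_weight s b s1 b1).
Qed.

Lemma cvg_truncated_moment s b : -1 < s -> -1 < b ->
  truncated_moment (eps n) s b @[n --> \oo] --> beta_moment s b.
Proof.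
move=> s1 b1; have := cvg_truncated_integral s b.
by rewrite EFin_beta_moment// => /fine_cvg.
Qed.

Let cvg_moment_defect s b : -1 < s -> -1 < b ->
  moment_defect (eps n) s b @[n --> \oo] --> (0 : R).
Proof.
move=> s1 b1; apply/norm_cvg0P.
have p t : -1 < t -> (eps n) `^ (t + 1) @[n --> \oo] --> (0 : R).
  move=> t1.
  apply: (@cvg_comp _ _ _ eps (fun x : R => x `^ (t + 1)) \oo (0^'+)).
    move=> A /eps_cvg A0; apply: (@filterS _ \oo _ _ _ _ A0) => n /=.
    by apply; exact: eps_gt0.
  by apply: powR_cvg0; lra.
apply: (@squeeze_cvgr _ _ _ _ (cst 0)
  (fun n => eps n `^ (s + 1) + eps n `^ (b + 1))).
- by apply: nearW => n; rewrite /= normr_ge0 normr_moment_defect.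
- exact: cvg_cst.
- by rewrite -[0 in X in _ --> X](addr0 (0 : R)); apply: cvgD; exact: p.
Qed.

(** The truncated recurrence passes to the limit, where the boundary term vanishes. *)
Lemma beta_moment_rec s b : -1 < s -> -1 < b ->
  (s + 1) * beta_moment s b = (s + b + 2) * beta_moment (s + 1) b.
Proof.
move=> s1 b1.
have l1 : (s + 1) * truncated_moment (eps n) s b @[n --> \oo]
    --> (s + 1) * beta_moment s b.
  by apply: cvgMr; exact: cvg_truncated_moment.
have l2 : (s + b + 2) * truncated_moment (eps n) (s + 1) b
      + moment_defect (eps n) s b @[n --> \oo]
    --> (s + b + 2) * beta_moment (s + 1) b + 0.
  apply: cvgD; last exact: cvg_moment_defect.
  by apply: cvgMr; apply: cvg_truncated_moment => //; lra.
rewrite addr0 in l2; apply: (cvg_unique _ l1) => //=.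
by under eq_fun do rewrite truncated_moment_recl//.
Qed.

Lemma beta_moment_gt0 s b : -1 < s -> -1 < b -> 0 < beta_moment s b.
Proof.
move=> s1 b1; rewrite -lte_fin -EFin_beta_moment//.
(* On the middle third both x and 1 - x lie in [1/3, 1], and there y^t >= y^|t| >= (1/3)^|t|,
   whatever the sign of t. *)
pose c : R := 3^-1 `^ `|s| * 3^-1 `^ `|b|.
have c0 : 0 < c by rewrite mulr_gt0// powR_gt0.
apply: (@lt_le_trans _ _ (\int[mu]_(x in `[3^-1%R, (1 - 3^-1)%R]) c%:E)%E).
  rewrite integral_cst//= lebesgue_measure_itv/= lte_fin ifT; last by lra.
  by rewrite -EFinB -EFinM lte_fin mulr_gt0//; lra.
apply: (@le_trans _ _ (\int[mu]_(x in `[3^-1%R, (1 - 3^-1)%R])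
    (beta_weight s b x)%:E)%E).
  apply: ge0_le_integral => //.
  - by move=> x _; rewrite lee_fin ltW.
  - by apply/measurable_EFinP; exact: measurable_beta_weight.
  - move=> x /=; rewrite in_itv/= => /andP[x0 x1].
    have p y t : 3^-1 <= y <= 1 -> 3^-1 `^ `|t| <= y `^ t.
      case/andP=> y0 y1; apply: (@le_trans _ _ (y `^ `|t|)).
        by apply: ge0_ler_powR; rewrite ?nnegrE//; lra.
      by apply: ger_powR; [lra|exact: ler_norm].
    by rewrite lee_fin ler_pM ?powR_ge0// p//; lra.
apply: ge0_subset_integral => //.
- by apply/measurable_EFinP; exact: measurable_beta_weight.
- by move=> x _; rewrite lee_fin beta_weight_ge0.
- by move=> x /=; rewrite !in_itv/=; lra.
Qed.

End beta_moment.

(** * Rising factorials *)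

Section rising_factorial.
Context {R : comNzRingType}.
Implicit Types (x : R) (m n : nat).

Definition rising x n : R := \prod_(k < n) (x + k%:R).

Lemma rising0 x : rising x 0 = 1. Proof. exact: big_ord0. Qed.

Lemma risingSr x n : rising x n.+1 = rising x n * (x + n%:R).
Proof. exact: big_ord_recr. Qed.

Lemma risingSl x n : rising x n.+1 = x * rising (x + 1) n.
Proof.
rewrite /rising big_ord_recl /= addr0; congr (_ * _).
by apply: eq_bigr => i _; rewrite -addrA -mulrS.
Qed.

Lemma risingD x m n : rising x (m + n) = rising x m * rising (x + m%:R) n.
Proof.
elim: n => [|n IH]; first by rewrite addn0 rising0 mulr1.
by rewrite addnS !risingSr IH natrD -!mulrA addrA.
Qed.

(** Reverse the order of the factors and take a sign out of each. *)
Lemma rising_reflect x n : rising x n = (-1) ^+ n * rising (1 - x - n%:R) n.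
Proof.
have -> : (-1) ^+ n = \prod_(i < n) (-1 : R) by rewrite prodr_const card_ord.
rewrite /rising (reindex_inj rev_ord_inj)/= -big_split/=; apply: eq_bigr => i _.
by rewrite natrB// mulrSr; ring.
Qed.

Lemma rising_oppn_eq0 m n : (m < n)%N -> rising (- m%:R) n = 0.
Proof. by move=> mn; rewrite /rising (bigD1 (Ordinal mn))//= addNr mul0r. Qed.

End rising_factorial.

Lemma rising_gt0 {R : realFieldType} (x : R) n :
  ((0 < n)%N -> 0 < x) -> 0 < rising x n.
Proof.
case: n => [|n] x0; first by rewrite rising0.
by apply: prodr_gt0 => k _; rewrite ltr_wpDr// x0.
Qed.

Lemma rising_shift_ratio {R : fieldType} (x : R) n :
  rising (x + 1) n != 0 -> x + n%:R != 0 ->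
  rising x n / rising (x + 1) n = x / (x + n%:R).
Proof.
move=> r0 xn0; apply/eqP; rewrite eqr_div//; apply/eqP.
by rewrite -risingSr risingSl.
Qed.

(** * Moments of polynomials *)

Section moment_functional.
Context {R : realType}.
Implicit Types (s b : R) (p : {poly R}).
Local Notation mu := (@lebesgue_measure R).

(** Defining the moment through the coefficients makes linearity and the shift under multiplication
    by x purely algebraic; [integral_poly_moment] links it to the integral. *)
Definition poly_moment s b p : R :=
  \sum_(i < size p) p`_i * beta_moment (s + i%:R) b.

Lemma poly_moment_widen m s b p : (size p <= m)%N ->
  poly_moment s b p = \sum_(i < m) p`_i * beta_moment (s + i%:R) b.
Proof.
move=> pm; rewrite /poly_moment.
rewrite (big_ord_widen m (fun i => p`_i * beta_moment (s + i%:R) b))//.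
rewrite big_mkcond/=; apply: eq_bigr => i _; case: ltnP => // ip.
by rewrite nth_default// mul0r.
Qed.

Lemma poly_momentD s b p q :
  poly_moment s b (p + q) = poly_moment s b p + poly_moment s b q.
Proof.
have sm := size_polyD p q.
rewrite (poly_moment_widen _ _ _ _ sm).
rewrite (poly_moment_widen (maxn (size p) (size q)) _ _ p) ?leq_maxl//.
rewrite (poly_moment_widen (maxn (size p) (size q)) _ _ q) ?leq_maxr//.
by rewrite -big_split/=; apply: eq_bigr => i _; rewrite coefD mulrDl.
Qed.

Lemma poly_momentZ s b c p : poly_moment s b (c *: p) = c * poly_moment s b p.
Proof.
rewrite (poly_moment_widen _ _ _ _ (size_scale_leq c p)) mulr_sumr.
by apply: eq_bigr => i _; rewrite coefZ mulrA.
Qed.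

Lemma poly_moment_sum s b (I : Type) (r : seq I) (P : pred I)
    (F : I -> {poly R}) :
  poly_moment s b (\sum_(i <- r | P i) F i)
  = \sum_(i <- r | P i) poly_moment s b (F i).
Proof.
apply: (big_morph (poly_moment s b)); first exact: poly_momentD.
by rewrite /poly_moment size_poly0 big_ord0.
Qed.

Lemma poly_momentMX s b p : poly_moment s b ('X * p) = poly_moment (s + 1) b p.
Proof.
rewrite (poly_moment_widen (size p).+1); last first.
  by rewrite (leq_trans (size_polyMleq _ _))// size_polyX.
rewrite big_ord_recl coefXM/= mul0r add0r; apply: eq_bigr => i _.
by rewrite coefXM/= -addrA -mulrS.
Qed.

(** At x = 0 the exponent law could only fail for s + k = 0 with k > 0, which s > -1 excludes. *)
Lemma exprM_powR (x s : R) k : 0 <= x -> -1 < s ->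
  x ^+ k * x `^ s = x `^ (s + k%:R).
Proof.
move=> x0 s1; case: k => [|k]; first by rewrite mul1r addr0.
rewrite powRD; first by rewrite powR_mulrn// mulrC.
by rewrite gt_eqF//; have := ler0n R k; rewrite mulrS; lra.
Qed.

Lemma integral_poly_moment s b p k : -1 < s -> -1 < b ->
  (\int[mu]_(x in `[0%R, 1%R]%classic)
     (p.[x] * x ^+ k * (x `^ s) * ((1 - x) `^ b))%:E
   = (poly_moment (s + k%:R) b p)%:E)%E.
Proof.
move=> s1 b1.
have si1 i : -1 < s + k%:R + i%:R.
  by have := ler0n R k; have := ler0n R i; lra.
transitivity (\int[mu]_(x in `[0%R, 1%R]) \sum_(i < size p)
    ((p`_i)%:E * (beta_weight (s + k%:R + i%:R) b x)%:E))%E.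
  apply: eq_integral => x; rewrite inE/= in_itv/= => /andP[x0 x1].
  under eq_bigr do rewrite -EFinM.
  rewrite sumEFin horner_coef; congr EFin; rewrite !mulr_suml.
  apply: eq_bigr => i _; rewrite /beta_weight !mulrA; congr (_ * _).
  rewrite -addrA -natrD -exprM_powR// exprD; ring.
rewrite integral_sum//; last first.
  move=> i; apply: integrableZl => //.
  by apply: integrable_beta_weight.
rewrite /poly_moment -sumEFin; apply: eq_bigr => i _.
rewrite integralZl//; last exact: integrable_beta_weight.
by rewrite EFin_beta_moment.
Qed.

Lemma beta_moment_rising s b i : -1 < s -> -1 < b ->
  beta_moment (s + i%:R) b * rising (s + b + 2) i
  = beta_moment s b * rising (s + 1) i.
Proof.
move=> s1 b1; elim: i => [|i IH]; first by rewrite addr0 !rising0.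
rewrite !risingSr [RHS]mulrA -IH mulrS.
have := ler0n R i => i0.
have -> : s + (1 + i%:R) = s + i%:R + 1 by ring.
have E := beta_moment_rec (s + i%:R) b _ b1.
transitivity (rising (s + b + 2) i
  * ((s + i%:R + b + 2) * beta_moment (s + i%:R + 1) b)); first by ring.
by rewrite -E; [ring|lra].
Qed.

End moment_functional.

(** * The polynomial T attached to the moments *)

Section moment_transform.
Context {R : realType}.
Implicit Types (s b x : R) (p : {poly R}) (N : nat).

(** This is T, with ['X] standing for s: the i-th term is p_i B(s + i) / B(s) multiplied by the
    common denominator (s + b + 2)_N, whose first i factors cancel. *)
Definition moment_transform b N p : {poly R} :=
  \sum_(i < N.+1)
    p`_i *: (rising ('X + 1) i * rising ('X + (b + 2 + i%:R)%:P) (N - i)).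

Lemma horner_rising (q : {poly R}) n x : (rising q n).[x] = rising q.[x] n.
Proof.
rewrite horner_prod; apply: eq_bigr => i _.
by rewrite hornerD -polyC_natr hornerC.
Qed.

Lemma size_risingX (c : R) n : size (rising ('X + c%:P) n) = n.+1.
Proof.
rewrite /rising (eq_bigr (fun k : 'I_n => 'X - (- (c + k%:R))%:P)); last first.
  by move=> k _; rewrite -polyC_natr polyCN polyCD opprK addrA.
by rewrite size_prod_XsubC -[in RHS](card_ord n) cardT enumT.
Qed.

Lemma horner_moment_transform b N p x : (moment_transform b N p).[x]
  = \sum_(i < N.+1)
      p`_i * (rising (x + 1) i * rising (x + b + 2 + i%:R) (N - i)).
Proof.
rewrite /moment_transform horner_sum; apply: eq_bigr => i _.
by rewrite hornerZ hornerM !horner_rising !hornerE.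
Qed.

Lemma size_moment_transform b N p : (size (moment_transform b N p) <= N.+1)%N.
Proof.
apply: (leq_trans (size_sum _ _ _)); apply/bigmax_leqP => i _.
rewrite (leq_trans (size_scale_leq _ _))// (leq_trans (size_polyMleq _ _))//.
by rewrite -polyC1 !size_risingX addSn/= addnS ltnS subnKC// -ltnS.
Qed.

Lemma poly_momentE s b N p : -1 < s -> -1 < b -> (size p <= N.+1)%N ->
  poly_moment s b p * rising (s + b + 2) N
  = beta_moment s b * (moment_transform b N p).[s].
Proof.
move=> s1 b1 sp; rewrite (poly_moment_widen N.+1)// horner_moment_transform.
rewrite mulr_suml mulr_sumr; apply: eq_bigr => i _.
have iN : (i <= N)%N by rewrite -ltnS.
have -> : rising (s + b + 2) N
    = rising (s + b + 2) i * rising (s + b + 2 + i%:R) (N - i).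
  by rewrite -risingD subnKC.
rewrite -mulrA (mulrA (beta_moment _ _)) beta_moment_rising//; ring.
Qed.

(** At this point s + b + 2 + i = -(N - i - 1), so for i < N the second rising factorial contains
    the factor 0. *)
Lemma moment_transform_lead b N p : (moment_transform b N p).[- b - 1 - N%:R]
  = p`_N * ((-1) ^+ N * rising (b + 1) N).
Proof.
rewrite horner_moment_transform big_ord_recr/= subnn rising0 mulr1.
rewrite big1 ?add0r => [|i _].
  rewrite rising_reflect; congr (_ * (_ * rising _ _)); ring.
have iN : (i < N)%N := ltn_ord i.
rewrite (_ : _ + i%:R = - (N - i.+1)%:R).
  by rewrite rising_oppn_eq0 ?mulr0//; lia.
by rewrite natrB// [i.+1%:R]mulrSr; ring.
Qed.

(** One unit further right the factor 0 occurs only for i < N, the degree being N + 1. Reflection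
    turns the last two terms into multiples of (b + 1)_N. *)
Lemma moment_transform_sublead b N p :
  (moment_transform b N.+1 p).[- b - N.+1%:R]
  = (-1) ^+ N.+1 * rising (b + 1) N * (p`_N.+1 * b - p`_N).
Proof.
rewrite horner_moment_transform !big_ord_recr/= subnn subSnn rising0 mulr1.
rewrite big1 ?add0r => [|i _].
  have N1 : N.+1%:R = N%:R + 1 :> R by rewrite mulrSr.
  have -> : rising (- b - N.+1%:R + b + 2 + N%:R) 1 = 1.
    by rewrite risingSr rising0 N1; ring.
  rewrite (rising_reflect _ N) (rising_reflect _ N.+1).
  have -> : 1 - (- b - N.+1%:R + 1) - N%:R = b + 1 by rewrite N1; ring.
  have -> : 1 - (- b - N.+1%:R + 1) - N.+1%:R = b by rewrite N1; ring.
  by rewrite risingSl exprS; ring.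
have iN : (i < N)%N := ltn_ord i.
rewrite (_ : _ + i%:R = - (N - i.+1)%:R).
  by rewrite rising_oppn_eq0 ?mulr0//; lia.
by rewrite natrB// [i.+1%:R]mulrSr [N.+1%:R]mulrSr; ring.
Qed.

End moment_transform.

(** * Factorization of T for a Jacobi-Piñeiro polynomial *)

Section jacobi_pineiro_transform.
Context {R : realType} {r : nat} (alpha : 'I_r -> R) (b : R).
Hypothesis alpha_gt : forall i, -1 < alpha i.
Hypothesis b_gt : -1 < b.
Hypothesis alpha_diff :
  forall i j : 'I_r, i != j -> alpha i - alpha j \isn't a Num.int.
Implicit Types (n : multi_index r) (p : {poly R}) (x : R).

(** The constant K: up to sign, the value of T at -b - 1 - N divided by the product over its zeros
    at that point. *)
Definition jp_norm n : R :=
  rising (b + 1) (weight n)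
  / \prod_(i < r) rising ((weight n)%:R + alpha i + b + 1) (n i).

Let nodes n : seq R :=
  [seq alpha i + k%:R | i <- index_enum 'I_r, k <- iota 0 (n i)].

(** A coincidence between nodes of different i and j would make alpha_i - alpha_j an integer. *)
Let uniq_nodes n : uniq (nodes n).
Proof.
apply: allpairs_uniq_dep; first exact: index_enum_uniq.
  by move=> i _; exact: iota_uniq.
move=> [i k] [j l] _ _ /= ikjl; have [ij|ij] := eqVneq i j.
  by move: ikjl; rewrite ij => /addrI/eqP; rewrite eqr_nat => /eqP ->.
have /negP[] := alpha_diff _ _ ij.
have -> : alpha i - alpha j = l%:R - k%:R by lra.
by rewrite rpredB ?natr_int.
Qed.

Let size_nodes n : size (nodes n) = weight n.
Proof.
rewrite size_allpairs_dep sumnE big_map /weight.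
by apply: eq_bigr => i _; rewrite size_iota.
Qed.

Let horner_nodes n x : (\prod_(z <- nodes n) ('X - z%:P)).[x]
  = (-1) ^+ weight n * \prod_(i < r) rising (alpha i - x) (n i).
Proof.
rewrite big_allpairs_dep horner_prod /weight expr_sum -big_split/=.
apply: eq_bigr => i _.
have -> : (-1) ^+ n i = \prod_(k < n i) (-1 : R).
  by rewrite prodr_const card_ord.
rewrite horner_prod -big_split/= -{1}[n i]subn0.
rewrite -/(index_iota 0 (n i)) big_mkord.
by apply: eq_bigr => k _; rewrite !hornerE; ring.
Qed.

Lemma weight_gt0 n i : (0 < n i)%N -> (0 < weight n)%N.
Proof. by move=> ni; rewrite /weight (bigD1 i)//= addn_gt0 ni. Qed.

(** A positive n_i forces |n| >= 1, which outweighs alpha_i + t + 1 > -1. For n_i = 0 the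
    corresponding rising factorial is empty. *)
Lemma jp_base_gt0 n i t : -1 < t -> (0 < n i)%N ->
  0 < (weight n)%:R + alpha i + t + 1.
Proof.
move=> t1 /weight_gt0; rewrite -(ltr_nat R) => w; have := alpha_gt i.
have : 1 <= (weight n)%:R :> R by rewrite ler1n -(ltr_nat R).
lra.
Qed.

Lemma rising_shift_neq0 n i t : -1 < t ->
  rising ((weight n)%:R + alpha i + t + 1) (n i) != 0.
Proof. by move=> t1; rewrite gt_eqF// rising_gt0// => /jp_base_gt0; exact. Qed.

Lemma jp_norm_neq0 n : jp_norm n != 0.
Proof.
apply: mulf_neq0.
  by rewrite gt_eqF//; apply: rising_gt0 => _; rewrite -ltrBlDr sub0r.
rewrite invr_eq0.
by apply/prodf_neq0 => i _; exact: rising_shift_neq0.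
Qed.

Lemma jacobi_pineiro_orthogonal n p i k : is_jacobi_pineiro alpha b n p ->
  (k < n i)%N -> poly_moment (alpha i + k%:R) b p = 0.
Proof.
by move=> [_ _ orth] /orth; rewrite integral_poly_moment// => -[].
Qed.

Lemma jacobi_pineiro_transform n p x : is_jacobi_pineiro alpha b n p ->
  (moment_transform b (weight n) p).[x]
  = (-1) ^+ weight n * jp_norm n * \prod_(i < r) rising (alpha i - x) (n i).
Proof.
move=> jp; have [p_monic sp _] := jp.
set N := weight n; set T := moment_transform b N p.
(* The Beta moment is positive, so each vanishing moment of p is a zero of T. *)
have T_nodes : all (root T) (nodes n).
  apply/allP => _ /allpairsPdep[i [k [_ + ->]]]; rewrite mem_iota/= add0n => kn.
  have m0 := jacobi_pineiro_orthogonal n p i k jp kn.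
  have s1 : -1 < alpha i + k%:R by have := alpha_gt i; have := ler0n R k; lra.
  have := poly_momentE (alpha i + k%:R) b N p s1 b_gt.
  rewrite sp leqnn m0 mul0r => /(_ isT)/esym/eqP.
  by rewrite mulf_eq0 gt_eqF ?beta_moment_gt0.
have [q Tq] :=
  uniq_roots_prod_XsubC T_nodes (etrans (uniq_rootsE _) (uniq_nodes n)).
(* T has degree at most N and the node product has degree N, so the cofactor is constant. *)
have [c qc] : exists c, q = c%:P.
  suff : (size q <= 1)%N by move/size1_polyC; exists q`_0.
  have [->|q0] := eqVneq q 0; first by rewrite size_poly0.
  have := size_moment_transform b N p; rewrite -/T Tq size_Mmonic//; last first.
    exact: monic_prod_XsubC.
  by rewrite size_prod_XsubC size_nodes -/N addnS/= -addn1 addnC leq_add2l.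
have Tx y : T.[y] = c * (-1) ^+ N * \prod_(i < r) rising (alpha i - y) (n i).
  by rewrite Tq qc hornerM hornerC horner_nodes mulrA.
rewrite Tx; congr (_ * _); apply/esym; rewrite [RHS]mulrC; congr (_ * _).
(* Since p is monic, the value of T at -b - 1 - N fixes c. *)
have pN : p`_N = 1 by have /monicP := p_monic; rewrite /lead_coef sp.
have := moment_transform_lead b N p; rewrite -/T Tx pN mul1r.
rewrite /jp_norm -/N mulrAC mulrC => /mulrI.
rewrite unitrX ?unitrN1// => /(_ isT) <-.
rewrite -mulrA (eq_bigr (fun i => rising (N%:R + alpha i + b + 1) (n i))).
  rewrite divff ?mulr1//; apply/prodf_neq0 => i _; exact: rising_shift_neq0.
by move=> i _; congr rising; ring.
Qed.

End jacobi_pineiro_transform.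

(** * Closed formulas and their continuity in beta *)

Section closed_forms.
Context {R : realType} {r : nat} (alpha : 'I_r -> R).
Hypothesis alpha_gt : forall i, -1 < alpha i.
Implicit Types (n : multi_index r) (i j k : 'I_r) (t b : R).

Lemma weight_incr_at n k : weight (incr_at n k) = (weight n).+1.
Proof.
rewrite /weight (bigD1 k)//= [in RHS](bigD1 k)//= ffunE eqxx addn1 addSn.
by congr (_ + _).+1; apply: eq_bigr => i /negbTE ik; rewrite ffunE ik addn0.
Qed.

Lemma weight_decr_at n j : (0 < n j)%N -> weight n = (weight (decr_at n j)).+1.
Proof.
move=> nj; rewrite /weight (bigD1 j)//= [in RHS](bigD1 j)//= ffunE eqxx.
rewrite -addSn subn1 prednK//; congr (_ + _)%N.
by apply: eq_bigr => i /negbTE ij; rewrite ffunE ij subn0.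
Qed.

(* Unlike [jp_delta] and [jp_a], the two functions below have no vanishing
   denominator for t > -1. *)
Definition jp_delta_reg t n : R :=
  t - ((weight n)%:R + t)
    * \prod_(i < r) (rising ((weight n)%:R + alpha i + t) (n i)
                     / rising ((weight n)%:R + alpha i + t + 1) (n i)).

Definition jp_a_reg t n j : R :=
  (\prod_(i < r | i != j)
      (((n j)%:R + alpha j - alpha i)
       / ((n j)%:R - (n i)%:R + alpha j - alpha i)))
  * (((weight n)%:R + t)
     * \prod_(i < r) (rising ((weight n)%:R + alpha i + t) (decr_at n j i)
                      / rising ((weight n)%:R + alpha i + t + 1) (n i)))
  * ((n j)%:R * ((n j)%:R + alpha j)
     / (((weight n)%:R + (n j)%:R + alpha j + t + 1)
        * ((weight n)%:R + (n j)%:R + alpha j + t))).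

(** With x = |n| + alpha_i + t, each factor of q_r / Q_r is x / (x + n_i), a telescoped ratio of
    rising factorials. *)
Lemma jp_delta_regE t n : -1 < t ->
  (forall i, (weight n)%:R + alpha i + t + (n i)%:R != 0) ->
  jp_delta alpha t n = jp_delta_reg t n.
Proof.
move=> t1 nz; rewrite /jp_delta /jp_q /jp_Q /jp_delta_reg -prodf_div.
rewrite addrC mulNr; congr (_ - _ * _); apply: eq_bigr => i _.
rewrite rising_shift_ratio ?rising_shift_neq0//.
have -> : - (weight n)%:R - t - alpha i = - ((weight n)%:R + alpha i + t).
  by ring.
have -> : - (weight n)%:R - t - (n i)%:R - alpha i
  = - ((weight n)%:R + alpha i + t + (n i)%:R) by ring.
by rewrite invrN mulrNN.
Qed.

Lemma jp_a_regE t n j : -1 < t ->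
  (forall i, (weight n)%:R + alpha i + t + (n i)%:R != 0) ->
  (weight n)%:R + (n j)%:R + alpha j + t - 1 != 0 ->
  jp_a alpha t n j = jp_a_reg t n j.
Proof.
move=> t1 nz nz1; rewrite /jp_a /jp_a_reg.
have [nj0|] := posnP (n j); first by rewrite nj0 !(mulr0, mul0r).
case E : (n j) => [//|m] _.
rewrite -!mulrA; congr (_ * _).
rewrite [in LHS](bigD1 j)//= [in RHS](bigD1 j)//= ffunE eqxx E subn1/=.
have -> : \prod_(i < r | i != j)
     (rising ((weight n)%:R + alpha i + t) (decr_at n j i)
        / rising ((weight n)%:R + alpha i + t + 1) (n i))
  = \prod_(i < r | i != j) (((weight n)%:R + alpha i + t)
        / ((weight n)%:R + (n i)%:R + alpha i + t)).
  apply: eq_bigr => i /negbTE ij; rewrite ffunE ij subn0.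
  rewrite rising_shift_ratio ?rising_shift_neq0//.
  by congr (_ / _); ring.
set G := \prod_(i < r | _) _; set x := (weight n)%:R + alpha j + t.
have xm : x + m.+1%:R != 0 by have := nz j; rewrite E.
have xm1 : x + m%:R != 0.
  by move: nz1; rewrite E /x mulrSr; apply: contraNneq => h; apply/eqP; lra.
have r0 : rising (x + 1) m.+1 != 0.
  by have := rising_shift_neq0 alpha alpha_gt n j t t1; rewrite E.
(* For i = j the numerator is one factor shorter, which produces the additional denominator |n| +
   n_j + alpha_j + t - 1. *)
have -> : rising x m / rising (x + 1) m.+1
    = x / ((x + m%:R) * (x + m.+1%:R)).
  apply/eqP; rewrite eqr_div ?mulf_neq0//; apply/eqP.
  by rewrite mulrA -risingSr -risingSr risingSl.
rewrite -/x.
have -> : (weight n)%:R + m.+1%:R + alpha j + t = x + m.+1%:R.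
  by rewrite /x; ring.
have -> : x + m.+1%:R - 1 = x + m%:R by rewrite mulrSr addrA addrK.
by rewrite !invfM; ring.
Qed.

Lemma cvg_prodr (T I : Type) (F : set_system T) (FF : Filter F) (s : seq I)
    (f : I -> T -> R) (l : I -> R) : (forall z, f z x @[x --> F] --> l z) ->
  \prod_(z <- s) f z x @[x --> F] --> \prod_(z <- s) l z.
Proof.
move=> fl; have h := @cvg_big R I *%R 1 xpredT mul_continuous T F s f l FF.
by apply: h => i _; exact: fl.
Qed.

Lemma cvg_rising (T : Type) (F : set_system T) (FF : Filter F) (f : T -> R)
    (l : R) m : f x @[x --> F] --> l ->
  rising (f x) m @[x --> F] --> rising l m.
Proof.
move=> fl; rewrite /rising.
apply: (@cvg_prodr _ _ _ _ _ (fun (i : 'I_m) x => f x + i%:R)) => i.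
by apply: cvgD => //; exact: cvg_cst.
Qed.

Let cvg_shift (c b : R) : c + t @[t --> b] --> c + b.
Proof. by apply: cvgD; [exact: cvg_cst|exact: cvg_id]. Qed.

Lemma cvg_rising_ratio b n (i : 'I_r) m : -1 < b ->
  rising ((weight n)%:R + alpha i + t) m
    / rising ((weight n)%:R + alpha i + t + 1) (n i) @[t --> b]
  --> rising ((weight n)%:R + alpha i + b) m
    / rising ((weight n)%:R + alpha i + b + 1) (n i).
Proof.
move=> b1; apply: cvgM; first by apply: cvg_rising; exact: cvg_shift.
apply: cvgV; first exact: rising_shift_neq0.
apply: cvg_rising; apply: cvgD; last exact: cvg_cst.
exact: cvg_shift.
Qed.

Lemma cvg_jp_delta_reg b n : -1 < b ->
  jp_delta_reg t n @[t --> b] --> jp_delta_reg b n.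
Proof.
move=> b1; apply: cvgB; first exact: cvg_id.
apply: cvgM; first exact: cvg_shift.
by apply: cvg_prodr => i; exact: cvg_rising_ratio.
Qed.

Lemma cvg_jp_a_reg b n j : -1 < b ->
  jp_a_reg t n j @[t --> b] --> jp_a_reg b n j.
Proof.
(* For n_j = 0 the last denominator may vanish at b, but the factor n_j makes the function
   identically 0. *)
move=> b1; have [nj0|nj] := posnP (n j).
  rewrite /jp_a_reg nj0 !(mulr0, mul0r).
  by under eq_fun do rewrite !(mulr0, mul0r); exact: cvg_cst.
apply: cvgM.
  apply: cvgM; first exact: cvg_cst.
  apply: cvgM; first exact: cvg_shift.
  by apply: cvg_prodr => i; exact: cvg_rising_ratio.
apply: cvgM; first exact: cvg_cst.
have g := jp_base_gt0 alpha alpha_gt n j b b1 nj.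
have n1 : 1 <= (n j)%:R :> R by rewrite ler1n.
apply: cvgV; first by rewrite mulf_neq0//; rewrite gt_eqF//; lra.
apply: cvgM; last exact: cvg_shift.
apply: cvgD; last exact: cvg_cst.
exact: cvg_shift.
Qed.

(** The only zero is t = -c; it is either b itself, which is punctured out, or at a positive
    distance from b. *)
Lemma near_dnbhs_shift_neq0 b (c : R) : \forall t \near b^', c + t != 0.
Proof.
have [cb|cb] := eqVneq (c + b) 0.
  near=> t; rewrite (_ : c = - b); last by lra.
  by rewrite addrC subr_eq0; near: t; exact: nbhs_dnbhs_neq.
apply: nbhs_dnbhs; exact: (cvgr_neq0 _ (cvg_shift c b)).
Unshelve. all: by end_near. Qed.

Lemma near_dnbhs_regular b n : -1 < b ->
  \forall t \near b^', -1 < t /\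
    forall i, (weight n)%:R + alpha i + t + (n i)%:R != 0.
Proof.
move=> b1; apply: filterI.
  by apply: nbhs_dnbhs; exact: lt_nbhsr.
have h i : \forall t \near b^', (weight n)%:R + alpha i + t + (n i)%:R != 0.
  by near=> t; rewrite addrAC; near: t; exact: near_dnbhs_shift_neq0.
exact: (@filter_forall R 'I_r
  (fun i t => (weight n)%:R + alpha i + t + (n i)%:R != 0) b^' _ h).
Unshelve. all: by end_near. Qed.

(** Near b but away from it the literal formula agrees with the regular one, which is continuous at
    b. *)
Lemma cvg_jp_delta b n : -1 < b ->
  jp_delta alpha t n @[t --> b^'] --> jp_delta_reg b n.
Proof.
move=> b1; apply: cvg_trans (cvg_within_filter _ (cvg_jp_delta_reg b n b1)).
apply: near_eq_cvg; near=> t.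
have [t1 nz] : -1 < t /\ forall i, (weight n)%:R + alpha i + t + (n i)%:R != 0.
  by near: t; exact: near_dnbhs_regular.
by rewrite jp_delta_regE.
Unshelve. all: by end_near. Qed.

Lemma cvg_jp_a b n j : -1 < b ->
  jp_a alpha t n j @[t --> b^'] --> jp_a_reg b n j.
Proof.
move=> b1; apply: cvg_trans (cvg_within_filter _ (cvg_jp_a_reg b n j b1)).
apply: near_eq_cvg; near=> t.
have [t1 nz] : -1 < t /\ forall i, (weight n)%:R + alpha i + t + (n i)%:R != 0.
  by near: t; exact: near_dnbhs_regular.
rewrite jp_a_regE// addrAC; near: t; exact: near_dnbhs_shift_neq0.
Unshelve. all: by end_near. Qed.

End closed_forms.

(** * Subleading and recurrence coefficients *)

Section recurrence_coefficients.
Context {R : realType} {r : nat} (alpha : 'I_r -> R) (b : R).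
Hypothesis alpha_gt : forall i, -1 < alpha i.
Hypothesis b_gt : -1 < b.
Hypothesis alpha_diff :
  forall i j : 'I_r, i != j -> alpha i - alpha j \isn't a Num.int.
Implicit Types (n : multi_index r) (p : {poly R}).

(** For N = |n| > 0, T(-b - N) is computed from the two top coefficients and from the zeros; the
    common factor (-1)^N (b + 1)_(N - 1) cancels. *)
Lemma jacobi_pineiro_subleading n p : is_jacobi_pineiro alpha b n p ->
  subleading (weight n) p = jp_delta_reg alpha b n.
Proof.
move=> jp; have [/monicP p_monic sp _] := jp; rewrite /jp_delta_reg.
case Nw : (weight n) => [|N] /=.
  (* Here n = 0: all products are trivial and the formula gives b - b, the default value of
     [subleading]. *)
  have n0 i : n i = 0%N.
    by apply/eqP; rewrite -leqn0 -Nw /weight (bigD1 i)//= leq_addr.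
  rewrite big1 => [|i _]; last by rewrite n0 !rising0 divr1.
  by rewrite add0r mulr1 subrr.
have := jacobi_pineiro_transform alpha b alpha_gt b_gt alpha_diff n p
  (- b - N.+1%:R) jp.
rewrite Nw moment_transform_sublead -!mulrA => /mulrI.
rewrite unitrX ?unitrN1// => /(_ isT).
have -> : p`_N.+1 = 1 by rewrite -p_monic /lead_coef sp Nw.
have r0 : rising (b + 1) N != 0.
  by rewrite gt_eqF// rising_gt0// => _; rewrite -ltrBlDr sub0r.
rewrite /jp_norm Nw risingSr -!mulrA => /(mulfI r0).
rewrite prodf_div mul1r => E; apply/eqP; rewrite eq_sym subr_eq addrC -subr_eq.
rewrite E; apply/eqP; congr (_ * _); first by rewrite mulrSr; ring.
rewrite mulrC; congr (_ / _); apply: eq_bigr => i _; congr rising.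
by ring.
Qed.

Lemma jacobi_pineiro_moment n p s : is_jacobi_pineiro alpha b n p -> -1 < s ->
  poly_moment s b p * rising (s + b + 2) (weight n)
  = beta_moment s b * ((-1) ^+ weight n * jp_norm alpha b n
                       * \prod_(i < r) rising (alpha i - s) (n i)).
Proof.
move=> jp s1; rewrite poly_momentE//; last by have [_ -> _] := jp.
by rewrite (jacobi_pineiro_transform _ _ alpha_gt b_gt alpha_diff _ _ _ jp).
Qed.

(** Lowering the weight by one moves the base |n| + alpha_i + b + 1 down to |n| + alpha_i + b; this
    is the source of the numerators in [jp_a_reg]. *)
Lemma jp_norm_decr_at n (j : 'I_r) : (0 < n j)%N ->
  jp_norm alpha b n = jp_norm alpha b (decr_at n j)
    * (((weight n)%:R + b)
       * \prod_(i < r) (rising ((weight n)%:R + alpha i + b) (decr_at n j i)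
                        / rising ((weight n)%:R + alpha i + b + 1) (n i))).
Proof.
move=> nj; rewrite /jp_norm (weight_decr_at n j nj) prodf_div risingSr mulrSr.
rewrite [X in _ = _ / X * _](eq_bigr (fun i =>
  rising ((weight (decr_at n j))%:R + 1 + alpha i + b) (decr_at n j i))).
  set x := \prod_(i < r) rising _ (decr_at n j i).
  have x0 : x != 0.
    apply/prodf_neq0 => i _.
    have := rising_shift_neq0 alpha alpha_gt (decr_at n j) i b b_gt.
    rewrite (_ : _ + 1 = (weight (decr_at n j))%:R + 1 + alpha i + b)//.
    by ring.
  rewrite -!mulrA; congr (_ * _); rewrite [RHS]mulrCA mulKf//.
  by congr (_ * _); ring.
by move=> i _; congr rising; ring.
Qed.

Lemma alpha_shift_neq0 (i j : 'I_r) (x : R) : i != j -> x \is a Num.int ->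
  alpha i - alpha j + x != 0.
Proof.
move=> /alpha_diff ij xint; apply: contraNneq ij => /eqP.
by rewrite addr_eq0 => /eqP ->; rewrite rpredN.
Qed.

Lemma rising_alpha_neq0 (i j : 'I_r) (m k : nat) : i != j ->
  rising (alpha i - (alpha j + m%:R)) k != 0.
Proof.
move=> ij; apply/prodf_neq0 => l _.
rewrite (_ : _ + l%:R = alpha i - alpha j + (l%:R - m%:R)); last by ring.
by rewrite alpha_shift_neq0// rpredB ?natr_int.
Qed.

(** These are the zero products of T for P_n and for P_(n - e_j) one unit lower. For i = j only the
    first factor -n_j is extra; for i != j the arguments differ by one and the ratio telescopes. *)
Lemma prod_rising_decr_at n (j : 'I_r) : (0 < n j)%N ->
  \prod_(i < r) rising (alpha i - (alpha j + (n j)%:R)) (n i)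
  = \prod_(i < r) rising (alpha i - (alpha j + (n j).-1%:R)) (decr_at n j i)
    * (- (n j)%:R * \prod_(i < r | i != j)
      (((n j)%:R + alpha j - alpha i)
       / ((n j)%:R - (n i)%:R + alpha j - alpha i))).
Proof.
case E : (n j) => [//|m] _ /=; rewrite (bigD1 j)//= [in RHS](bigD1 j)//=.
rewrite E ffunE eqxx E subn1/= risingSl.
have -> : alpha j - (alpha j + m.+1%:R) = - m.+1%:R by ring.
have -> : - m.+1%:R + 1 = alpha j - (alpha j + m%:R) by rewrite mulrSr; ring.
rewrite [RHS]mulrACA [_ * - _]mulrC; congr (_ * _).
rewrite -big_split/=; apply: eq_bigr => i ij; rewrite ffunE (negbTE ij) subn0.
have -> : alpha i - (alpha j + m%:R) = alpha i - (alpha j + m.+1%:R) + 1.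
  by rewrite [m.+1%:R]mulrSr; ring.
have zn0 : alpha i - (alpha j + m.+1%:R) + (n i)%:R != 0.
  rewrite (_ : _ + _ = alpha i - alpha j + ((n i)%:R - m.+1%:R)); last by ring.
  by rewrite alpha_shift_neq0// rpredB ?natr_int.
have r0 : rising (alpha i - (alpha j + m.+1%:R) + 1) (n i) != 0.
  have := rising_alpha_neq0 i j m (n i) ij; congr (rising _ _ != 0).
  by rewrite [m.+1%:R]mulrSr; ring.
rewrite (_ : _ / _ = (alpha i - (alpha j + m.+1%:R))
                     / (alpha i - (alpha j + m.+1%:R) + (n i)%:R)).
  by rewrite -rising_shift_ratio// mulrC mulfVK.
have -> : m.+1%:R + alpha j - alpha i = - (alpha i - (alpha j + m.+1%:R)).
  by ring.
have -> : m.+1%:R - (n i)%:R + alpha j - alpha i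
  = - (alpha i - (alpha j + m.+1%:R) + (n i)%:R) by ring.
by rewrite invrN mulrNN.
Qed.

(** The nodes of n - e_j in direction j stop at alpha_j + n_j - 2, and those in other directions
    differ from alpha_j + n_j - 1 by a non-integer. *)
Lemma poly_moment_decr_at_neq0 n (j : 'I_r) p : (0 < n j)%N ->
  is_jacobi_pineiro alpha b (decr_at n j) p ->
  poly_moment (alpha j + (n j).-1%:R) b p != 0.
Proof.
move=> nj jp; have s1 : -1 < alpha j + (n j).-1%:R.
  by have := alpha_gt j; have := ler0n R (n j).-1; lra.
have E := jacobi_pineiro_moment _ _ _ jp s1.
have : beta_moment (alpha j + (n j).-1%:R) b
  * ((-1) ^+ weight (decr_at n j) * jp_norm alpha b (decr_at n j)
     * \prod_(i < r) rising (alpha i - (alpha j + (n j).-1%:R)) (decr_at n j i))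
  != 0.
  rewrite mulf_neq0 ?(gt_eqF (beta_moment_gt0 _ _ s1 b_gt))//.
  apply: mulf_neq0.
    by apply: mulf_neq0; [rewrite signr_eq0|exact: jp_norm_neq0].
  apply/prodf_neq0 => i _; have [->|ij] := eqVneq i j.
    rewrite ffunE eqxx subn1; apply/prodf_neq0 => -[l /= lj] _.
    rewrite (_ : _ + _ = l%:R - (n j).-1%:R); last by ring.
    by rewrite subr_eq0 eqr_nat ltn_eqF.
  exact: rising_alpha_neq0.
by rewrite -E; apply: contraNneq => ->; rewrite mul0r.
Qed.

(** Every other polynomial in the relation has at least n_j orthogonality conditions in direction j,
    hence zero moment at alpha_j + n_j - 1. *)
Lemma recurrence_coefficient_moment (P : multi_index r -> {poly R})
    (u v : multi_index r -> 'I_r -> R) n (j : 'I_r) :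
  (forall n, is_jacobi_pineiro alpha b n (P n)) ->
  nearest_neighbor_recurrence P u v -> (0 < n j)%N ->
  poly_moment (alpha j + (n j)%:R) b (P n)
  = u n j * poly_moment (alpha j + (n j).-1%:R) b (P (decr_at n j)).
Proof.
move=> jp [_ rec] nj; set s := alpha j + (n j).-1%:R.
have orth n' : ((n j).-1 < n' j)%N -> poly_moment s b (P n') = 0.
  exact: (jacobi_pineiro_orthogonal alpha b alpha_gt b_gt).
have -> : alpha j + (n j)%:R = s + 1.
  by rewrite /s -{1}(prednK nj) mulrSr addrA.
rewrite -poly_momentMX (rec n j) !poly_momentD poly_momentZ poly_moment_sum.
rewrite (orth (incr_at n j)); last first.
  by rewrite ffunE eqxx addn1 prednK// ltnW.
rewrite (orth n) ?prednK// mulr0 !add0r.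
rewrite (bigD1 j)//= big1 ?addr0 => [|i /andP[_ ij]]; first exact: poly_momentZ.
rewrite poly_momentZ orth ?mulr0// ffunE eq_sym (negbTE ij) subn0.
by rewrite prednK.
Qed.

Lemma recurrence_coefficientE (P : multi_index r -> {poly R})
    (u v : multi_index r -> 'I_r -> R) n (j : 'I_r) :
  (forall n, is_jacobi_pineiro alpha b n (P n)) ->
  nearest_neighbor_recurrence P u v -> u n j = jp_a_reg alpha b n j.
Proof.
move=> jp rec; have [nj0|nj] := posnP (n j).
  by rewrite (rec.1 _ _ nj0) /jp_a_reg nj0 !(mulr0, mul0r).
have M2 := poly_moment_decr_at_neq0 n j (P (decr_at n j)) nj (jp _).
apply: (mulIf M2); rewrite -(recurrence_coefficient_moment _ _ _ _ _ jp rec nj).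
have nj1 : (n j)%:R = (n j).-1%:R + 1 :> R by rewrite -{1}(prednK nj) mulrSr.
set s := alpha j + (n j).-1%:R in M2 *.
have s1 : -1 < s.
  by have := alpha_gt j; have := ler0n R (n j).-1; rewrite /s; lra.
have sE : alpha j + (n j)%:R = s + 1 by rewrite nj1 addrA.
have s2 : -1 < s + 1 by lra.
have E1 := jacobi_pineiro_moment _ _ _ (jp n) s2.
have E2 := jacobi_pineiro_moment _ _ _ (jp (decr_at n j)) s1.
have Eb := beta_moment_rec s b s1 b_gt.
have EF := prod_rising_decr_at n j nj.
rewrite sE -/s in EF; rewrite sE.
rewrite EF (jp_norm_decr_at n j nj) in E1.
rewrite /jp_a_reg.
set G := \prod_(i < r | i != j) _ in E1 *.
move: E1; set H := (_ + b) * _ => E1.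
have wN := weight_decr_at n j nj; set N := weight (decr_at n j) in E2 E1 wN.
(* Both sides are (s + b + 2)_(N + 2); the last two factors q and q + 1 become the final
   denominators of [jp_a_reg]. *)
have Er : rising (s + 1 + b + 2) (weight n) * (s + b + 2)
  = rising (s + b + 2) N * ((s + b + 2 + N%:R) * (s + b + 2 + N%:R + 1)).
  rewrite wN mulrC (_ : s + 1 + b + 2 = s + b + 2 + 1); last by ring.
  by rewrite -risingSl !risingSr [N.+1%:R]mulrSr; ring.
have N0 := ler0n R N.
have X0 : rising (s + b + 2) N != 0.
  have c0 : 0 < s + b + 2 by have := b_gt; lra.
  by rewrite gt_eqF// rising_gt0.
set q := s + b + 2 + N%:R in Er.
have q0 : 0 < q by have := b_gt; rewrite /q; lra.
have -> : (weight n)%:R + (n j)%:R + alpha j + b = q.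
  by rewrite wN nj1 [N.+1%:R]mulrSr /q /s; ring.
have -> : (n j)%:R + alpha j = s + 1 by rewrite addrC sE.
have q1 : q + 1 != 0 by rewrite gt_eqF//; lra.
have {}q0 : q != 0 by rewrite gt_eqF.
suff E : poly_moment (s + 1) b (P n) * (q * (q + 1))
  = (s + 1) * (n j)%:R * H * G * poly_moment s b (P (decr_at n j)).
  by apply: (mulIf (mulf_neq0 q0 q1)); rewrite E; field; rewrite q0.
apply: (mulIf X0).
transitivity (poly_moment (s + 1) b (P n) * rising (s + 1 + b + 2) (weight n)
  * (s + b + 2)); first by rewrite -[RHS]mulrA Er; ring.
rewrite E1 -[RHS]mulrA E2 wN exprS.
set K := jp_norm _ _ _; set F := \prod_(i < r) rising _ _.
(* The additional sign in (-1)^(N + 1) cancels the one of -n_j, and the Beta recurrence trades s + b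
   + 2 for s + 1 = n_j + alpha_j. *)
transitivity ((s + b + 2) * beta_moment (s + 1) b
  * ((-1) ^+ N * K * H * F * (n j)%:R * G)); first by ring.
by rewrite -Eb; ring.
Qed.

End recurrence_coefficients.

(* For exceptional parameters a factor of the closed formulas for a_{n,j} and
   delta_n reads 0/0 because of a common factor of numerator and denominator
   (for example alpha_j + beta = -1 with n = e_j, or alpha_j + beta = 0 with
   n = 0).  Each formula is asserted literally whenever its denominators do not
   vanish, and for all parameters as a value by continuity in beta. *)
Theorem mainTheorem7 (R : realType) (r : nat) (alpha : 'I_r -> R) (beta : R)
    (P : multi_index r -> {poly R}) (a b : multi_index r -> 'I_r -> R)
    (hr : (1 <= r)%N)
    (halpha : forall i : 'I_r, -1 < alpha i)
    (hbeta : -1 < beta)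
    (hdiff : forall i j : 'I_r, i != j -> alpha i - alpha j \isn't a Num.int)
    (hnormal : forall n : multi_index r,
       exists! p : {poly R}, is_jacobi_pineiro alpha beta n p)
    (hP : forall n : multi_index r, is_jacobi_pineiro alpha beta n (P n))
    (hrec : nearest_neighbor_recurrence P a b) :
  [/\ (forall (n : multi_index r) (j : 'I_r),
         (forall i : 'I_r,
            (weight n)%:R + (n i)%:R + alpha i + beta != 0) ->
         (weight n)%:R + (n j)%:R + alpha j + beta + 1 != 0 ->
         (weight n)%:R + (n j)%:R + alpha j + beta - 1 != 0 ->
         a n j = jp_a alpha beta n j),
      (forall (n : multi_index r) (j : 'I_r),
         jp_a alpha t n j @[t --> beta^'] --> a n j),
      (forall (n : multi_index r) (k : 'I_r),
         b n k = subleading (weight n) (P n)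
                 - subleading (weight (incr_at n k)) (P (incr_at n k))),
      (forall n : multi_index r,
         jp_Q alpha n (- (weight n)%:R - beta) != 0 ->
         subleading (weight n) (P n) = jp_delta alpha beta n) &
      (forall n : multi_index r,
         jp_delta alpha t n @[t --> beta^'] --> subleading (weight n) (P n))].
Proof.
have sub n :=
  jacobi_pineiro_subleading alpha beta halpha hbeta hdiff n _ (hP n).
have coefE n j :=
  recurrence_coefficientE alpha beta halpha hbeta hdiff P a b n j hP hrec.
split.
- move=> n j nz _ nz1; rewrite coefE jp_a_regE// => i.
  by rewrite addrAC (addrAC _ (alpha i)) nz.
- by move=> n j; rewrite coefE; exact: cvg_jp_a.
- move=> n k; have [_ rec] := hrec.
  have size_P m : size (P m) = (weight m).+1 by have [] := hP m.
  (* In the coefficient of x^|n| the polynomials P_(n - e_j), of degree |n| - 1, drop out. *)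
  have := congr1 (fun p : {poly R} => p`_(weight n)) (rec n k).
  rewrite coefXM !coefD coefZ coef_sum big1 ?addr0 => [|j nj]; last first.
    by rewrite coefZ nth_default ?mulr0// size_P -weight_decr_at.
  have [/monicP mP _ _] := hP n.
  have -> : (P n)`_(weight n) = 1 by rewrite -mP /lead_coef size_P.
  rewrite mulr1 weight_incr_at /=.
  (* For |n| = 0 the zero constant term of ['X * P n] matches the default value of [subleading]. *)
  by case: (weight n) => [|m] /= E;
    rewrite [X in _ = X - _]E addrAC subrr add0r.
- move=> n Q0; rewrite sub jp_delta_regE// => i.
  (* The factors of Q_r at -|n| - beta are the negatives of the required denominators. *)
  move: Q0 => /prodf_neq0/(_ i isT); apply: contraNneq => h.
  by rewrite -oppr_eq0 -h; apply/eqP; ring.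
- by move=> n; rewrite sub; exact: cvg_jp_delta.
Qed.
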